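(* For every $1\le\delta\le\frac65$ we have $\alpha_{\star}(\delta,2)\ge\frac{4\delta}{3}$. For every $\frac65\le\delta<2$ we have $\alpha_{\star}(\delta,2)\ge 1+\frac{\delta}{2}$.
   Context: All logarithms are in base $2$. $G_{n,\frac12}$ denotes the random graph on vertex set $V=\{1,\dots,n\}$ in which each of the $\binom n2$ pairs of vertices is an edge independently with probability $\frac12$. Probe model with $\ell$ rounds. An algorithm has unbounded computation time and accesses the input graph $G$ only by probes; a probe of a pair $(i,j)$, $1\le i<j\le n$, reveals whether $(i,j)$ is an edge of $G$. The algorithm proceeds in $\ell$ rounds: in round $1$ it selects a set $E_1$ of pairs and the status (edge or non-edge) of all pairs in $E_1$ is revealed; for $2 \le i\le \ell$, in round $i$ it selects a set $E_i$ of pairs, depending on the outcomes of the probes in rounds $1,\dots,i-1$, and the status of all pairs in $E_i$ is revealed. All probes of one round are done in parallel. After round $\ell$ the algorithm outputs a set of vertices, which it has to ensure is a clique of $G$. The total number of probes is $\sum_{i=1}^{\ell}|E_i|$. $\alpha_{\star}(\delta,\ell)$ is the supremum over all $\alpha$ such that there exists an algorithm (one for each $n$) that, on a graph drawn at random from $G_{n,\frac12}$, probes at most $n^{\delta}$ entries of the adjacency matrix, with the probes being done in $\ell$ rounds, and outputs a clique of size at least $\alpha\log n$ with probability at least $\frac12$, for all sufficiently large $n$. *)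

(* Defs.v *)
From HB Require Import structures.
From mathcomp Require Import all_boot all_order all_algebra.
From mathcomp Require Import all_classical all_reals all_analysis.

Set Implicit Arguments.
Unset Strict Implicit.
Unset Printing Implicit Defensive.

Import Order.TTheory GRing.Theory Num.Theory.
Local Open Scope classical_set_scope.
Local Open Scope ring_scope.

(* The vertex set {1, ..., n} is rendered as 'I_n = {0, ..., n - 1}. *)
Definition vpair (n : nat) := {p : 'I_n * 'I_n | (p.1 < p.2)%N}.

(* A graph is identified with its edge set. *)
Definition graph (n : nat) := {set vpair n}.

Definition is_clique (n : nat) (G : graph n) (S : {set 'I_n}) : bool :=
  [forall e : vpair n,
     ((val e).1 \in S) && ((val e).2 \in S) ==> (e \in G)].

(* G_{n,p}: independence of the pairs is the product form of the weight. *)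
Definition gnp_weight (R : realType) (n : nat) (p : R) (G : graph n) : R :=
  \prod_(e : vpair n) (if e \in G then p else 1 - p).

Definition gnp_prob (R : realType) (n : nat) (p : R) (A : pred (graph n)) : R :=
  \sum_(G : graph n | A G) gnp_weight p G.

(* One entry (E, F) per completed round, in chronological order: E is the set
   of pairs probed and F the set of those revealed to be edges, so that the
   pairs in E but not in F are the revealed non-edges. *)
Definition history (n : nat) := seq ({set vpair n} * {set vpair n}).

(* [select A h] is the set probed in the round that follows the history h,
   and [output A h] is the answer if the algorithm stops after h.  Both are
   arbitrary functions: the computation time is unbounded. *)
Record algorithm (n : nat) := Algorithm {
  select : history n -> {set vpair n};
  output : history n -> {set 'I_n}
}.

Fixpoint run (n : nat) (A : algorithm n) (G : graph n) (l : nat) : history n :=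
  if l is l'.+1 then
    let h := run A G l' in
    let E := select A h in
    rcons h (E, G :&: E)
  else [::].

Definition num_probes (n : nat) (A : algorithm n) (l : nat) (G : graph n) : nat :=
  (\sum_(i < l) #|select A (run A G i)|)%N.

Definition result (n : nat) (A : algorithm n) (l : nat) (G : graph n) :
    {set 'I_n} :=
  output A (run A G l).

(* The answer has to be a clique on every input, not just with high
   probability. *)
Definition ensures_clique (n : nat) (A : algorithm n) (l : nat) : Prop :=
  forall G : graph n, is_clique G (result A l G).

Definition log2 (R : realType) (x : R) : R := ln x / ln 2.

(* The probe budget binds on every input; only the size of the clique is
   subject to the probability 1/2. *)
Definition achievable (R : realType) (delta : R) (l : nat) (alpha : R) : Prop :=
  exists A : forall n : nat, algorithm n,
    (forall n : nat, ensures_clique (A n) l) /\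
    \forall n \near \oo,
      (forall G : graph n, (num_probes (A n) l G)%:R <= n%:R `^ delta) /\
      2^-1 <= gnp_prob (2^-1 : R)
                (fun G : graph n =>
                   alpha * log2 n%:R <= #|result (A n) l G|%:R).

(* The supremum is taken in the extended reals, where it always exists. *)
Definition alpha_star (R : realType) (delta : R) (l : nat) : \bar R :=
  ereal_sup [set alpha%:E | alpha in [set alpha : R | achievable delta l alpha]].

(* Main.v *)
Require Import Defs.
From HB Require Import structures.
From mathcomp Require Import all_boot all_order all_algebra.
From mathcomp Require Import all_classical all_reals all_analysis.
From mathcomp Require Import ring lra zify.

Set Implicit Arguments.
Unset Strict Implicit.
Unset Printing Implicit Defensive.

Import Order.TTheory GRing.Theory Num.Theory.
Local Open Scope ring_scope.

(** Write log for the logarithm in base 2.  Fix a > 0 with 3 a <= delta and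
    a + delta / 2 <= 1.  Two rounds suffice for a clique of size close to
    (a + delta) log n, and the two bounds are a = delta / 3 and
    a = 1 - delta / 2.

    Take disjoint vertex sets U and W with about n^(a/2) and n^(a + delta/2)
    vertices.  Round 1 probes all pairs inside U and between U and W, about
    n^a + n^(3a/2 + delta/2) <= 2 n^delta probes.  It finds a clique A in U
    of size about a log n, which is the clique number of a random graph on U,
    and the set N of the vertices of W joined to all of A.  About n^(delta/2)
    vertices of W survive, so that round 2 can probe all pairs inside N, where
    there is a clique B of size about delta log n.  Then A together with B is
    the answer.  An arbitrarily small loss in the exponents absorbs all
    factors that are polynomial in log n.

    Three events have to be excluded.  That N is too large is excluded by the
    Markov inequality ([card_joint_markov]).  That A or B does not exist is
    excluded by a single second-moment estimate ([clique_extension]), which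
    for a fixed set A bounds the probability that no k-subset B of W completes
    A: both the pairs inside B and those between A and B must be edges.  The
    sets B counted are those with one vertex in each of k blocks of s
    vertices.  If two such sets have m common vertices, then at most
    m (|A| + k/2) of the required pairs coincide.  As this is linear in m, the
    second moment factorizes over the blocks and is at most (1 + 2^(|A| + k/2) / s)^k times the squared first moment.

    The set A depends on the pairs inside U alone, whereas the last two
    events, for a given A, depend on the other pairs alone.  Independence is
    used in the form of resampling ([mean_mix]): a graph that takes its pairs
    inside U from G and all others from an independent H is again uniformly
    random. *)

(** * Expectation over a uniformly random set *)

Definition mean (R : realType) (T : finType) (f : {set T} -> R) : R :=
  2^-1 ^+ #|T| * \sum_(G : {set T}) f G.

Lemma gnp_prob_half (R : realType) (n : nat) (P : pred (graph n)) :
  gnp_prob (2^-1 : R) P = mean (fun G => (P G)%:R).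
Proof.
rewrite /gnp_prob /mean big_mkcond mulr_sumr; apply: eq_bigr => G _.
case: ifP => _; rewrite ?mulr0 // mulr1 /gnp_weight.
rewrite (eq_bigr (fun=> 2^-1 : R)); first by rewrite prodr_const cardT -cardE.
by move=> e _; case: ifP => // _; field.
Qed.

Lemma mean_cst (R : realType) (T : finType) (c : R) :
  mean (fun _ : {set T} => c) = c.
Proof.
rewrite /mean sumr_const.
have -> : #|{: {set T}}| = (2 ^ #|T|)%N.
  by rewrite -[in RHS]cardsT -card_powerset powersetT cardsT.
by rewrite -[c *+ _]mulr_natl mulrA natrX -exprMn mulVf ?expr1n ?mul1r ?pnatr_eq0.
Qed.

Lemma eq_mean (R : realType) (T : finType) (f g : {set T} -> R) :
  (forall G, f G = g G) -> mean f = mean g.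
Proof. by move=> eq_fg; congr mean; apply: funext. Qed.

Lemma meanD (R : realType) (T : finType) (f g : {set T} -> R) :
  mean (fun G => f G + g G) = mean f + mean g.
Proof. by rewrite /mean big_split mulrDr. Qed.

Lemma meanZ (R : realType) (T : finType) (c : R) (f : {set T} -> R) :
  mean (fun G => c * f G) = c * mean f.
Proof. by rewrite /mean -mulr_sumr mulrCA. Qed.

Lemma mean_sum (R : realType) (T I : finType) (P : pred I)
    (F : I -> {set T} -> R) :
  mean (fun G => \sum_(i | P i) F i G) = \sum_(i | P i) mean (F i).
Proof. by rewrite /mean exchange_big mulr_sumr. Qed.

Lemma le_mean (R : realType) (T : finType) (f g : {set T} -> R) :
  (forall G, f G <= g G) -> mean f <= mean g.
Proof.
by move=> le_fg; rewrite ler_pM2l ?exprn_gt0 ?invr_gt0 ?ltr0n //; apply: ler_sum.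
Qed.

Lemma mean_subset (R : realType) (T : finType) (D : {set T}) :
  mean (fun G => (D \subset G)%:R : R) = 2^-1 ^+ #|D|.
Proof.
have card_up : #|[set G : {set T} | D \subset G]| = (2 ^ #|~: D|)%N.
  rewrite -card_powerset.
  rewrite -(@card_imset _ _ (@finset.setC T) _ (inv_inj (@finset.setCK T))).
  apply: eq_card => G; rewrite powersetE.
  apply/imsetP/idP => [[H + ->]|sGD]; first by rewrite inE finset.setCS.
  by exists (~: G); rewrite ?finset.setCK // inE -finset.setCS finset.setCK.
rewrite /mean -natr_sum -big_mkcond /= sum1dep_card card_up.
by rewrite -(cardsC D) exprD -mulrA natrX -exprMn mulVf ?expr1n ?mulr1 ?pnatr_eq0.
Qed.

Definition mix (T : finType) (E G H : {set T}) : {set T} :=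
  (G :&: E) :|: (H :\: E).

Lemma subset_mixl (T : finType) (E G H D : {set T}) :
  D \subset E -> (D \subset mix E G H) = (D \subset G).
Proof.
move/fintype.subsetP => sDE; apply/fintype.subsetP/fintype.subsetP => sD x Dx.
  by have := sD x Dx; rewrite !inE sDE //= andbT orbF.
by rewrite !inE sDE // sD.
Qed.

Lemma subset_mixr (T : finType) (E G H D : {set T}) :
  [disjoint D & E] -> (D \subset mix E G H) = (D \subset H).
Proof.
move=> dDE; apply/fintype.subsetP/fintype.subsetP => sD x Dx.
  by have := sD x Dx; rewrite !inE (disjointFr dDE Dx) andbF.
by rewrite !inE (disjointFr dDE Dx) sD // orbT.
Qed.

(** Swapping the traces of [G] and [H] outside [E] is an involution of the
    pairs (G, H), and [mix E G H] is the first component of the swapped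
    pair; so it is uniformly distributed. *)
Lemma mean_mix (R : realType) (T : finType) (E : {set T}) (f : {set T} -> R) :
  mean (fun G => mean (fun H => f (mix E G H))) = mean f.
Proof.
pose swap (p : {set T} * {set T}) := (mix E p.1 p.2, mix E p.2 p.1).
have swapK : involutive swap.
  by case=> G H; congr pair; apply/finset.setP => x; rewrite !inE;
    case: (x \in E); rewrite ?andbF ?andbT ?orbF.
rewrite -[RHS](@mean_cst R T); congr (_ * _).
transitivity (\sum_(G : {set T}) \sum_(H : {set T}) 2^-1 ^+ #|T| * f (mix E G H)).
  by apply: eq_bigr => G _; rewrite /mean mulr_sumr.
rewrite pair_bigA /= (reindex_inj (inv_inj swapK)) /=.
rewrite -(pair_bigA _ (fun G H => 2^-1 ^+ #|T| * f (mix E (mix E G H) (mix E H G)))) /=.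
rewrite exchange_big /=; apply: eq_bigr => H _.
rewrite /mean mulr_sumr; apply: eq_bigr => G _; congr (_ * f _).
by have [] := swapK (G, H).
Qed.

(** Chebyshev's inequality for the number of the sets [D i] contained in the
    random set, each counted with the inverse of its probability.  With these
    weights the mean is 1 whatever the sizes of the [D i], and the pair (i, j)
    contributes 2 to the power of the size of [D i :&: D j], divided by the
    number of pairs of indices, to the second moment. *)
Lemma second_moment (R : realType) (T I : finType) (D : I -> {set T}) (q : R) :
  (0 < #|I|)%N ->
  (forall i, \sum_j 2 ^+ #|D i :&: D j| <= #|I|%:R * q) ->
  mean (fun G => [forall i, ~~ (D i \subset G)]%:R) <= q - 1.
Proof.
move=> I_gt0 sumD.
have I0 : 0 < #|I|%:R :> R by rewrite ltr0n.
pose X (G : {set T}) : R := #|I|%:R^-1 * \sum_i 2 ^+ #|D i| * (D i \subset G)%:R.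
have X1 : mean X = 1.
  rewrite meanZ mean_sum (eq_bigr (fun=> 1)) => [|i _].
    by rewrite sumr_const mulVf ?gt_eqF.
  by rewrite meanZ mean_subset -exprMn divff ?expr1n ?pnatr_eq0.
have X2 : mean (fun G => X G ^+ 2) <= q.
  have -> : mean (fun G => X G ^+ 2) =
      #|I|%:R ^- 2 * \sum_i \sum_j 2 ^+ #|D i :&: D j|.
    under eq_mean => G do rewrite /X exprMn exprVn [X in _ * X]expr2 mulr_suml.
    rewrite meanZ mean_sum; congr (_ * _); apply: eq_bigr => i _.
    under eq_mean => G do rewrite mulr_sumr.
    rewrite mean_sum; apply: eq_bigr => j _.
    under eq_mean => G.
      rewrite mulrACA -natrM mulnb -finset.subUset -exprD. over.
    rewrite meanZ mean_subset -cardsUI exprD mulrAC -exprMn.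
    by rewrite divff ?expr1n ?mul1r ?pnatr_eq0.
  have -> : q = #|I|%:R ^- 2 * (\sum_(i : I) #|I|%:R * q).
    by rewrite sumr_const -[_ *+ _]mulr_natl; field; rewrite gt_eqF.
  by rewrite ler_pM2l ?invr_gt0 ?exprn_gt0 //; apply: ler_sum.
(* The failure indicator is at most (1 - X)^2, since X = 0 on failure. *)
apply: (@le_trans _ _ (mean (fun G => (X G ^+ 2 + (- 2) * X G) + 1))); last first.
  rewrite !meanD meanZ X1 mean_cst; lra.
apply: (@le_mean R T) => G.
have -> : X G ^+ 2 + -2 * X G + 1 = (1 - X G) ^+ 2 by ring.
case: (boolP [forall i, ~~ (D i \subset G)]) => [/forallP none|_]; last exact: sqr_ge0.
rewrite /X big1 ?mulr0 ?subr0 ?expr1n // => i _.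
by rewrite (negbTE (none i)) mulr0.
Qed.

(** * Pairs of vertices *)

Definition ends (n : nat) (e : vpair n) : {set 'I_n} :=
  [set (val e).1; (val e).2].

(** The pairs that must be edges for a clique [A] to extend to the clique
    [A :|: B].  For [A] empty these are all pairs inside [B]; for disjoint
    [U] and [W], [new_pairs W U] is the set of pairs inside [U] or between [U]
    and [W], i.e. the probes of the first round. *)
Definition new_pairs (n : nat) (A B : {set 'I_n}) : {set vpair n} :=
  [set e | (ends e \subset A :|: B) && ~~ (ends e \subset A)].

Lemma card_ends (n : nat) (e : vpair n) : #|ends e| = 2.
Proof. by rewrite cards2 -val_eqE neq_ltn (valP e). Qed.

Lemma ends_inj (n : nat) : injective (@ends n).
Proof.
move=> [[x y] /= lt_xy] [[z t] /= lt_zt] eq_e; apply/val_inj => /=.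
have {}eq_e : [set x; y] = [set z; t] := eq_e.
have [xe ye] : x \in [set z; t] /\ y \in [set z; t].
  by rewrite -eq_e !inE !eqxx orbT.
have [ze te] : z \in [set x; y] /\ t \in [set x; y].
  by rewrite eq_e !inE !eqxx orbT.
move: xe ye ze te; rewrite !inE.
move=> /orP[]/eqP ? /orP[]/eqP ?; subst => //; rewrite ?ltnn // in lt_xy lt_zt *.
by have := ltn_trans lt_xy lt_zt; rewrite ltnn.
Qed.

Lemma ends_surj (n : nat) (x y : 'I_n) :
  x != y -> exists e, ends e = [set x; y].
Proof.
rewrite -val_eqE neq_ltn => /orP[lt_xy|lt_yx].
  by exists (Sub (x, y) lt_xy); rewrite /ends SubK.
by exists (Sub (y, x) lt_yx); rewrite /ends SubK finset.setUC.
Qed.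

Lemma is_cliqueE (n : nat) (G : graph n) (S : {set 'I_n}) :
  is_clique G S = (new_pairs finset.set0 S \subset G).
Proof.
apply/forallP/fintype.subsetP => [cl e|sG e].
  rewrite inE finset.set0U => /andP[+ _].
  by rewrite finset.subUset !finset.sub1set => /(implyP (cl e)).
apply/implyP => eS; apply: sG.
rewrite inE finset.set0U finset.subUset !finset.sub1set eS /=.
by rewrite finset.subset0 -cards_eq0 card_ends.
Qed.

(** The endpoints form either a 2-subset of [B] or the image of a point of
    [A] times [B]. *)
Lemma card_new_pairs (n : nat) (A B : {set 'I_n}) :
  (#|new_pairs A B| <= #|A| * #|B| + 'C(#|B|, 2))%N.
Proof.
rewrite -(card_imset _ (@ends_inj n)) -cards_draws -cardsX.
pose pr (p : 'I_n * 'I_n) := [set p.1; p.2].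
apply: (@leq_trans #|(pr @: finset.setX A B) :|:
                     [set S : {set 'I_n} | S \subset B & #|S| == 2]|); last first.
  by apply: leq_trans (leq_card_setU _ _) _; rewrite leq_add2r leq_imset_card.
apply/subset_leq_card/fintype.subsetP => _ /imsetP[e + ->].
rewrite !inE card_ends eqxx andbT finset.subUset !finset.sub1set !inE.
rewrite finset.subUset !finset.sub1set => /andP[/andP[xAB yAB] nA].
rewrite finset.subUset !finset.sub1set.
have [xA|xA] := boolP ((val e).1 \in A).
  rewrite xA /= in nA; rewrite (negbTE nA) /= in yAB.
  apply/orP; left; apply/imsetP; exists (val e) => //.
  by rewrite inE xA yAB.
rewrite (negbTE xA) /= in xAB; rewrite xAB /=.
have [yB|yB] := boolP ((val e).2 \in B); first by rewrite orbT.
rewrite (negbTE yB) orbF in yAB.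
apply/orP; left; apply/imsetP; exists ((val e).2, (val e).1).
  by rewrite inE /= xAB yAB.
by rewrite /pr /= finset.setUC.
Qed.

Lemma card_new_pairs1 (n : nat) (A : {set 'I_n}) (w : 'I_n) :
  w \notin A -> (#|A| <= #|new_pairs A [set w]|)%N.
Proof.
move=> wA; rewrite -(card_imset _ (@ends_inj n)).
have pair_inj : {in A &, injective (fun a => [set a; w])}.
  move=> a b aA bA /finset.setP /(_ a); rewrite !inE eqxx /= => /esym.
  by case/orP => /eqP // eq_aw; rewrite -eq_aw aA in wA.
rewrite -(card_in_imset pair_inj).
apply/subset_leq_card/fintype.subsetP => _ /imsetP[a aA ->].
have aw : a != w by apply: contraNneq wA => <-.
have [e ee] := ends_surj aw; rewrite -ee; apply: imset_f; rewrite inE ee.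
by rewrite !finset.subUset !finset.sub1set !inE aA (negbTE wA) eqxx orbT.
Qed.

Lemma new_pairsS (n : nat) (A B C : {set 'I_n}) :
  B \subset C -> new_pairs A B \subset new_pairs A C.
Proof.
move=> sBC; apply/fintype.subsetP => e; rewrite !inE => /andP[sAB ->].
by rewrite andbT (fintype.subset_trans sAB) // finset.setUS.
Qed.

Lemma new_pairsI (n : nat) (A B C : {set 'I_n}) :
  new_pairs A B :&: new_pairs A C \subset new_pairs A (B :&: C).
Proof.
apply/fintype.subsetP => e; rewrite !inE => /andP[/andP[sAB ->] /andP[sAC _]].
by rewrite finset.setUIr finset.subsetI sAB sAC.
Qed.

(** This makes the extension of a clique of [U] independent of the pairs
    inside [U]. *)
Lemma disjoint_new_pairs (n : nat) (A B U : {set 'I_n}) :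
  A \subset U -> [disjoint B & U] ->
  [disjoint new_pairs A B & new_pairs finset.set0 U].
Proof.
move=> sAU dBU; rewrite finset.disjoints_subset; apply/fintype.subsetP => e.
rewrite !inE finset.set0U => /andP[sAB nA]; rewrite negb_and negbK.
apply/orP; left; apply: contra nA => sU.
have : ends e \subset (A :|: B) :&: U by rewrite finset.subsetI sAB.
rewrite finset.setIUl (disjoint_setI0 dBU) finset.setU0 => /fintype.subset_trans; apply.
exact: finset.subsetIl.
Qed.

Lemma new_pairs_fst (n : nat) (U W S : {set 'I_n}) :
  [disjoint W & U] -> S \subset U -> new_pairs finset.set0 S \subset new_pairs W U.
Proof.
move=> dWU sSU; apply/fintype.subsetP => e; rewrite !inE finset.set0U => /andP[sS ne].
have sU := fintype.subset_trans sS sSU.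
rewrite (fintype.subset_trans sU) ?finset.subsetUr //=.
apply: contra ne => sW.
by rewrite -(disjoint_setI0 dWU) finset.subsetI sW.
Qed.

Lemma new_pairs_cross (n : nat) (U W A : {set 'I_n}) (w : 'I_n) :
  [disjoint W & U] -> A \subset U -> w \in W ->
  new_pairs A [set w] \subset new_pairs W U.
Proof.
move=> dWU sAU wW; apply/fintype.subsetP => e; rewrite !inE => /andP[sAw _].
have sUW : A :|: [set w] \subset W :|: U.
  by rewrite finset.setUC finset.setUSS // finset.sub1set.
rewrite (fintype.subset_trans sAw sUW) /=; apply/negP => sW.
have : ends e \subset (A :|: [set w]) :&: W by rewrite finset.subsetI sAw.
have AW0 : A :&: W = finset.set0.
  apply/eqP; rewrite -finset.subset0 -(disjoint_setI0 dWU) finset.setIC.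
  exact: finset.setIS.
rewrite finset.setIUl AW0 finset.set0U => /subset_leq_card; rewrite card_ends.
move=> /leq_trans/(_ (subset_leq_card (finset.subsetIl _ _))).
by rewrite cards1.
Qed.

(** * Extending a clique by the second-moment method *)

Lemma block_embedding (V : finType) (W : {set V}) (k s : nat) :
  (k * s <= #|W|)%N ->
  exists phi : 'I_k * 'I_s -> V, injective phi /\ forall p, phi p \in W.
Proof.
move=> leW.
have le : (#|{: 'I_k * 'I_s}| <= #|W|)%N by rewrite card_prod !card_ord.
exists (fun p => enum_val (widen_ord le (enum_rank p))); split.
  move=> p q /enum_val_inj /(congr1 val) /= eq_pq.
  by apply: enum_rank_inj; apply: val_inj.
by move=> p; apply: enum_valP.
Qed.

(** The weight is a product over the coordinates, so the sum over all functions
    is the product over the coordinates of the sums over the values. *)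
Lemma sum_expr_agree (R : realType) (k s : nat) (t : R) (f : {ffun 'I_k -> 'I_s}) :
  0 <= t ->
  \sum_(g : {ffun 'I_k -> 'I_s}) t ^+ #|[set i | f i == g i]| <= (s%:R + t) ^+ k.
Proof.
move=> t0.
rewrite (eq_bigr (fun g : {ffun 'I_k -> 'I_s} =>
  \prod_i (if f i == g i then t else 1))) => [|g _].
  rewrite -(bigA_distr_bigA (fun i j => if f i == j then t else 1)).
  have -> : (s%:R + t) ^+ k = \prod_(i < k) (s%:R + t) by rewrite prodr_const card_ord.
  apply: ler_prod => i _; rewrite sumr_ge0 => [|j _]; last by case: ifP.
  rewrite (bigD1 (f i)) //= eqxx addrC lerD2r.
  rewrite (eq_bigr (fun=> 1)) => [|j /negbTE]; last by rewrite eq_sym => ->.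
  by rewrite sumr_const ler_nat -[leqRHS]card_ord max_card.
by rewrite -big_mkcond /= prodr_const cardsE.
Qed.

(** A bound linear in [m] is what turns the second moment into a product over
    the blocks. *)
Lemma bin2_le_half (m k : nat) : (m <= k)%N -> ('C(m, 2) <= m * k./2)%N.
Proof.
move=> le_mk; rewrite bin2.
suff : (m * m.-1 <= (m * k./2).*2)%N by move/half_leq; rewrite doubleK.
rewrite doubleMr; case: m le_mk => // m lt_mk; rewrite leq_mul2l /=.
by move: (odd_double_half k) lt_mk; case: odd => /=; lia.
Qed.

(** The Bernoulli inequality (1 + q)^k (1 - k q) <= 1, with 1 - k q >= 7/8. *)
Lemma expr1D_sub1_le (R : realFieldType) (q : R) (k : nat) :
  0 <= q -> k%:R * q <= 8^-1 -> (1 + q) ^+ k - 1 <= 7^-1.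
Proof.
move=> q0 kq.
have bern m : m%:R * q <= 8^-1 -> (1 + q) ^+ m * (1 - m%:R * q) <= 1.
  elim: m => [|m IH]; first by rewrite expr0 mul1r mul0r subr0.
  rewrite -natr1 mulrDl mul1r => mq.
  apply: le_trans (IH _); last by lra.
  rewrite exprSr -mulrA; apply: ler_wpM2l; first by rewrite exprn_ge0 //; lra.
  have : 0 <= m%:R * q by rewrite mulr_ge0.
  by nra.
have := bern k kq.
have : 0 <= (1 + q) ^+ k by rewrite exprn_ge0 //; lra.
have : 0 <= k%:R * q by rewrite mulr_ge0.
by nra.
Qed.

(** The second-moment method over the sets [B] that have one vertex in each of
    [k] blocks of [s] vertices of [W]; such a set is given by a function from
    the blocks to the positions in a block.  With [A] empty this finds a clique
    of size [k] in [W]. *)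
Lemma clique_extension (R : realType) (n k s : nat) (A W : {set 'I_n}) :
  (0 < s)%N -> (k * s <= #|W|)%N -> (8 * k * 2 ^ (#|A| + k./2) <= s)%N ->
  mean (fun G : graph n =>
    (~~ [exists B : {set 'I_n},
          [&& B \subset W, #|B| == k & new_pairs A B \subset G]])%:R) <= 7^-1 :> R.
Proof.
move=> s0 leW les; have [phi [phi_inj phiW]] := block_embedding leW.
pose t : R := 2 ^+ (#|A| + k./2).
have sR : 0 < s%:R :> R by rewrite ltr0n.
pose tv (f : {ffun 'I_k -> 'I_s}) := [set phi (i, f i) | i : 'I_k].
have tv_inj f : injective (fun i => phi (i, f i)) by move=> i j /phi_inj [].
(* Only the blocks on which f and g agree give common new pairs. *)
have agree f g : (#|new_pairs A (tv f) :&: new_pairs A (tv g)| <=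
    #|[set i | f i == g i]| * (#|A| + k./2))%N.
  apply: leq_trans (subset_leq_card (new_pairsI _ _ _)) _.
  apply: leq_trans (card_new_pairs _ _) _.
  have le_m : (#|tv f :&: tv g| <= #|[set i | f i == g i]|)%N.
    rewrite -(card_imset _ (tv_inj f)); apply/subset_leq_card/fintype.subsetP => v.
    rewrite inE => /andP[/imsetP[i _ ->] /imsetP[j _ /phi_inj[<- fg]]].
    by apply: imset_f; rewrite inE fg.
  rewrite mulnDr [(_ * #|A|)%N]mulnC leq_add ?leq_mul2l ?le_m ?orbT //.
  apply: leq_trans (leq_bin2l _ le_m) (bin2_le_half _).
  by rewrite -[leqRHS]card_ord max_card.
have t1 : 1 <= t by rewrite exprn_ege1 // ler1n.
have t0 : 0 <= t by apply: le_trans t1.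
apply: le_trans (@expr1D_sub1_le R (t / s%:R) k _ _).
- apply: le_trans (@second_moment R _ _ (fun f => new_pairs A (tv f)) _ _ _).
  + apply: le_mean => G; rewrite ler_nat.
    case: existsP => //= nex; rewrite lt0b; apply/forallP => f.
    apply/negP => sG; apply: nex; exists (tv f).
    rewrite sG card_imset // card_ord eqxx !andbT.
    by apply/fintype.subsetP => _ /imsetP[i _ ->].
  + by rewrite card_ffun !card_ord expn_gt0 s0.
  + move=> f; rewrite card_ffun !card_ord natrX -exprMn mulrDr mulr1 mulrC divfK ?gt_eqF //.
    apply: le_trans (sum_expr_agree f t0); apply: ler_sum => g _.
    by rewrite -exprM ler_eXn2l ?ltr1n // mulnC.
- by rewrite divr_ge0 // ltW.
- rewrite mulrA ler_pdivrMr //.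
  have : (8 * k * 2 ^ (#|A| + k./2))%:R <= s%:R :> R by rewrite ler_nat.
  rewrite !natrM natrX -/t; lra.
Qed.

(** * The two-round algorithm *)

(** The fallback [S0] keeps the size of the core and its position in [U]
    independent of the graph, so that the later steps can be analysed without
    assuming that the search in [U] succeeds. *)
Definition core (n : nat) (U S0 : {set 'I_n}) (F : graph n) : {set 'I_n} :=
  odflt S0 [pick S : {set 'I_n} |
    [&& S \subset U, #|S| == #|S0| & new_pairs finset.set0 S \subset F]].

(** For [A] disjoint from [W], the common neighbourhood of [A] in [W]. *)
Definition joint (n : nat) (W : {set 'I_n}) (F : graph n) (A : {set 'I_n}) :
    {set 'I_n} :=
  [set w in W | new_pairs A [set w] \subset F].

Definition known (n : nat) (h : history n) : graph n := \bigcup_(p <- h) p.2.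

(** The output is a largest clique among the pairs known to be edges, which is
    a clique of the graph whatever was probed.  The second round is skipped
    when the common neighbourhood exceeds [cap], because the budget binds on
    every graph. *)
Definition two_round (n : nat) (U W S0 : {set 'I_n}) (cap : nat) : algorithm n :=
  Algorithm
    (fun h => if h is [::] then new_pairs W U else
       let N := joint W (known h) (core U S0 (known h)) in
       if (#|N| <= cap)%N then new_pairs finset.set0 N else finset.set0)
    (fun h => [arg max_(S > finset.set0 | is_clique (known h) S) #|S|]).

Lemma is_clique0 (n : nat) (F : graph n) : is_clique F finset.set0.
Proof. by apply/forallP => e; rewrite inE. Qed.

Lemma known_run (n : nat) (A : algorithm n) (G : graph n) (l : nat) :
  known (run A G l) \subset G.
Proof.
elim: l => [|l IH] /=; first by rewrite /known big_nil finset.sub0set.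
by rewrite /known -cats1 big_cat big_seq1 /= finset.subUset IH finset.subsetIl.
Qed.

Lemma two_round_ensures (n : nat) (U W S0 : {set 'I_n}) (cap l : nat) :
  ensures_clique (two_round U W S0 cap) l.
Proof.
move=> G; rewrite /result [output _ _]/=.
case: arg_maxnP => [|S + _]; first exact: is_clique0.
by rewrite !is_cliqueE => /fintype.subset_trans; apply; apply: known_run.
Qed.

Lemma core_sub (n : nat) (U S0 : {set 'I_n}) (F : graph n) :
  S0 \subset U -> core U S0 F \subset U.
Proof. by move=> sS0U; rewrite /core; case: pickP => [S /and3P[sSU _ _]|_]. Qed.

Lemma card_core (n : nat) (U S0 : {set 'I_n}) (F : graph n) :
  #|core U S0 F| = #|S0|.
Proof. by rewrite /core; case: pickP => [S /and3P[_ /eqP cS _]|_]. Qed.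

Lemma eq_core (n : nat) (U S0 : {set 'I_n}) (F F' : graph n) :
  (forall S : {set 'I_n}, S \subset U ->
     (new_pairs finset.set0 S \subset F) = (new_pairs finset.set0 S \subset F')) ->
  core U S0 F = core U S0 F'.
Proof.
move=> eqF; rewrite /core; congr odflt; apply: eq_pick => S.
by case: (boolP (S \subset U)) => //= sSU; rewrite eqF.
Qed.

Lemma core_clique (n : nat) (U S0 : {set 'I_n}) (F : graph n) :
  [exists B : {set 'I_n},
     [&& B \subset U, #|B| == #|S0| & new_pairs finset.set0 B \subset F]] ->
  new_pairs finset.set0 (core U S0 F) \subset F.
Proof.
move=> /existsP[B cB]; rewrite /core; case: pickP => [S /and3P[]//|/(_ B)].
by rewrite cB.
Qed.

(** The first round reveals enough to compute the core, and likewise the common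
    neighbourhood in [joint_first]. *)
Lemma core_first (n : nat) (U W S0 : {set 'I_n}) (G : graph n) :
  [disjoint W & U] -> core U S0 (G :&: new_pairs W U) = core U S0 G.
Proof.
move=> dWU; apply: eq_core => S sSU.
by rewrite finset.subsetI (new_pairs_fst dWU sSU) andbT.
Qed.

Lemma joint_first (n : nat) (U W A : {set 'I_n}) (G : graph n) :
  [disjoint W & U] -> A \subset U ->
  joint W (G :&: new_pairs W U) A = joint W G A.
Proof.
move=> dWU sAU; apply/finset.setP => w; rewrite !inE.
case: (boolP (w \in W)) => //= wW.
by rewrite finset.subsetI (new_pairs_cross dWU sAU wW) andbT.
Qed.

(** The core is a function of the pairs inside [U], whereas by [joint_mix] the
    common neighbourhood of a given set is a function of the others. *)
Lemma core_mix (n : nat) (U S0 : {set 'I_n}) (G H : graph n) :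
  core U S0 (mix (new_pairs finset.set0 U) G H) = core U S0 G.
Proof. by apply: eq_core => S sSU; rewrite subset_mixl ?new_pairsS. Qed.

Lemma joint_mix (n : nat) (U W A : {set 'I_n}) (G H : graph n) :
  [disjoint W & U] -> A \subset U ->
  joint W (mix (new_pairs finset.set0 U) G H) A = joint W H A.
Proof.
move=> dWU sAU; apply/finset.setP => w; rewrite !inE.
case: (boolP (w \in W)) => //= wW; rewrite subset_mixr //.
apply: disjoint_new_pairs => //.
by rewrite disjoints1 (disjointFr dWU wW).
Qed.

(** A vertex of [W] is joined to all of [A] with probability 2^-|A|, so the
    expected size of the common neighbourhood is at most cap / 8. *)
Lemma card_joint_markov (R : realType) (n : nat) (W A : {set 'I_n}) (cap : nat) :
  [disjoint W & A] -> (0 < cap)%N -> (8 * #|W| <= cap * 2 ^ #|A|)%N ->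
  mean (fun G : graph n => (cap < #|joint W G A|)%N%:R) <= 8^-1 :> R.
Proof.
move=> dWA cap0 le_cap; have capR : 0 < cap%:R :> R by rewrite ltr0n.
apply: (@le_trans _ _ (mean (fun G : graph n => cap%:R^-1 * #|joint W G A|%:R))).
  apply: le_mean => G; rewrite mulrC ler_pdivlMr // -natrM ler_nat.
  by case: ltnP => [/ltnW|]; rewrite ?mul1n ?mul0n.
rewrite meanZ mulrC ler_pdivrMr //.
have -> : (fun G : graph n => #|joint W G A|%:R : R) =
    (fun G => \sum_(w in W) (new_pairs A [set w] \subset G)%:R).
  apply: funext => G; rewrite -natr_sum -sum1_card big_mkcond [in RHS]big_mkcond.
  by congr _%:R; apply: eq_bigr => w _; rewrite inE; case: (w \in W).
rewrite mean_sum; apply: (@le_trans _ _ (\sum_(w in W) 2^-1 ^+ #|A|)).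
  apply: ler_sum => w wW; rewrite mean_subset ler_wiXn2l ?invr_ge0 ?invf_le1 ?ler1n //.
  by apply: card_new_pairs1; rewrite (disjointFr dWA wW).
have : (8 * #|W|)%:R <= (cap * 2 ^ #|A|)%:R :> R by rewrite ler_nat.
rewrite sumr_const -[X in _ -> X <= _]mulr_natl exprVn ler_pdivrMr ?exprn_gt0 ?ltr0n //.
rewrite !natrM natrX; lra.
Qed.

Lemma two_round_probes (n : nat) (U W S0 : {set 'I_n}) (cap : nat) (G : graph n) :
  (num_probes (two_round U W S0 cap) 2 G <=
   #|W| * #|U| + #|U| * #|U| + cap * cap)%N.
Proof.
have bin2_sq m : ('C(m, 2) <= m * m)%N.
  by apply: leq_trans (bin2_le_half (leqnn m)) _; rewrite leq_mul2l; lia.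
rewrite /num_probes big_ord_recr big_ord1 /= leq_add //.
  by apply: leq_trans (card_new_pairs _ _) _; rewrite leq_add2l.
case: ifP => [le_cap|_]; last by rewrite cards0.
apply: leq_trans (card_new_pairs _ _) _; rewrite cards0 mul0n add0n.
by apply: leq_trans (bin2_sq _) _; rewrite leq_mul.
Qed.

(** The hypotheses are the three good events.  A vertex of [B] is joined to all
    of the core, so [B] lies in the common neighbourhood and the second round
    probes every pair inside [B]. *)
Lemma two_round_success (n : nat) (U W S0 : {set 'I_n}) (cap k2 : nat) (G : graph n) :
  [disjoint W & U] -> S0 \subset U ->
  let A := core U S0 G in
  [exists B : {set 'I_n},
     [&& B \subset U, #|B| == #|S0| & new_pairs finset.set0 B \subset G]] ->
  (#|joint W G A| <= cap)%N ->
  [exists B : {set 'I_n}, [&& B \subset W, #|B| == k2 & new_pairs A B \subset G]] ->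
  (#|S0| + k2 <= #|result (two_round U W S0 cap) 2 G|)%N.
Proof.
move=> dWU sS0U A /core_clique; rewrite -/A => clA le_cap.
move=> /existsP[B /and3P[sBW /eqP <- sABG]].
have sAU : A \subset U by apply: core_sub.
pose E1 := new_pairs W U; pose E2 := new_pairs finset.set0 (joint W G A).
have knownE : known (run (two_round U W S0 cap) G 2) = G :&: (E1 :|: E2).
  rewrite /= /known !big_cons !big_nil !finset.setU0 /= core_first // -/A.
  by rewrite joint_first // le_cap -finset.setIUr.
have dAB : [disjoint A & B].
  by apply: disjointWl sAU _; rewrite disjoint_sym; apply: disjointWl sBW _.
have sBN : B \subset joint W G A.
  apply/fintype.subsetP => w wB; rewrite inE (fintype.subsetP sBW) //=.
  by apply: fintype.subset_trans sABG; rewrite new_pairsS ?finset.sub1set.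
have cl : is_clique (G :&: (E1 :|: E2)) (A :|: B).
  rewrite is_cliqueE; apply/fintype.subsetP => e.
  rewrite [e \in new_pairs _ _]inE finset.set0U => /andP[sAB ne].
  rewrite inE; apply/andP; split.
    have [sA|nA] := boolP (ends e \subset A).
      by apply: (fintype.subsetP clA); rewrite inE finset.set0U sA.
    by apply: (fintype.subsetP sABG); rewrite inE sAB.
  rewrite inE; have [sW|nW] := boolP (ends e \subset W).
    apply/orP; right; rewrite inE finset.set0U ne andbT.
    apply: (fintype.subset_trans _ sBN).
    have : ends e \subset (A :|: B) :&: W by rewrite finset.subsetI sAB.
    rewrite finset.setIUl (_ : A :&: W = finset.set0).
      by rewrite finset.set0U => /fintype.subset_trans; apply; apply: finset.subsetIl.
    apply: disjoint_setI0; apply: disjointWl sAU _.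
    by rewrite disjoint_sym.
  apply/orP; left; rewrite inE nW andbT; apply: fintype.subset_trans sAB _.
  by rewrite finset.setUC finset.setUSS.
rewrite /result [output _ _]/= knownE; case: arg_maxnP => [|S _ /(_ _ cl)].
  exact: is_clique0.
apply: leq_trans.
by rewrite cardsU (disjoint_setI0 dAB) cards0 subn0 card_core.
Qed.

(** The failure probabilities add up to at most 1/7 + 1/8 + 1/7 < 1/2. *)
Lemma two_round_prob (R : realType) (n : nat) (U W S0 : {set 'I_n})
    (s1 s2 k2 cap : nat) :
  [disjoint W & U] -> S0 \subset U ->
  (0 < s1)%N -> (#|S0| * s1 <= #|U|)%N -> (8 * #|S0| * 2 ^ #|S0|./2 <= s1)%N ->
  (0 < s2)%N -> (k2 * s2 <= #|W|)%N -> (8 * k2 * 2 ^ (#|S0| + k2./2) <= s2)%N ->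
  (0 < cap)%N -> (8 * #|W| <= cap * 2 ^ #|S0|)%N ->
  2^-1 <= mean (fun G : graph n =>
    (#|S0| + k2 <= #|result (two_round U W S0 cap) 2 G|)%N%:R) :> R.
Proof.
move=> dWU sS0U s1_gt0 leU les1 s2_gt0 leW les2 cap0 le_cap.
pose good1 (G : graph n) := [exists B : {set 'I_n},
  [&& B \subset U, #|B| == #|S0| & new_pairs finset.set0 B \subset G]].
pose good2 (A : {set 'I_n}) (G : graph n) := (#|joint W G A| <= cap)%N.
pose good3 (A : {set 'I_n}) (G : graph n) := [exists B : {set 'I_n},
  [&& B \subset W, #|B| == k2 & new_pairs A B \subset G]].
pose E := new_pairs finset.set0 U.
have bad1 : mean (fun G => (~~ good1 G)%:R) <= 7^-1 :> R.
  by apply: (clique_extension _ s1_gt0 leU); rewrite cards0 add0n.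
have bad23 : mean (fun G => (~~ good2 (core U S0 G) G)%:R +
    (~~ good3 (core U S0 G) G)%:R) <= 8^-1 + 7^-1 :> R.
  (* Resample the pairs outside U: given G, the core A is then a fixed set, and
     the two events depend on the independent graph H only. *)
  rewrite -(mean_mix E) -[leRHS](@mean_cst R (vpair n)); apply: le_mean => G.
  have sAU := core_sub G sS0U; set A := core U S0 G in sAU.
  rewrite meanD; apply: lerD.
    under eq_mean => H do rewrite core_mix /good2 joint_mix // -ltnNge.
    apply: card_joint_markov => //; last by rewrite card_core.
    by rewrite disjoint_sym; apply: disjointWl sAU _; rewrite disjoint_sym.
  under eq_mean => H.
    rewrite core_mix (_ : good3 _ _ = good3 A H); first over.
    apply: eq_existsb => B; case: (boolP (B \subset W)) => //= sBW.
    rewrite subset_mixr //; apply: disjoint_new_pairs => //.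
    exact: disjointWl sBW _.
  by apply: (clique_extension _ s2_gt0 leW); rewrite card_core.
have sum_le : 1 <= mean (fun G : graph n =>
    ((#|S0| + k2 <= #|result (two_round U W S0 cap) 2 G|)%N%:R + (~~ good1 G)%:R) +
    ((~~ good2 (core U S0 G) G)%:R + (~~ good3 (core U S0 G) G)%:R)) :> R.
  rewrite -[leLHS](@mean_cst R (vpair n)); apply: le_mean => G.
  rewrite -!natrD ler1n.
  have [g1|_] := boolP (good1 G); last by rewrite /= !addn_gt0 orbT.
  have [g2|_] := boolP (good2 _ G); last by rewrite /= !addn_gt0 orbT.
  have [g3|_] := boolP (good3 _ G); last by rewrite /= !addn_gt0 orbT.
  by rewrite (two_round_success dWU sS0U g1 g2 g3).
rewrite !meanD in sum_le bad23; lra.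
Qed.

(** * Choice of the sizes *)

Lemma subset_of_card (T : finType) (B : {set T}) (m : nat) :
  (m <= #|B|)%N -> exists2 A : {set T}, A \subset B & #|A| = m.
Proof.
rewrite -bin_gt0 -cards_draws card_gt0 => /set0Pn[A].
by rewrite inE => /andP[sAB /eqP cA]; exists A.
Qed.

Lemma pow2_le_powR (R : realType) (n m : nat) (y : R) :
  (0 < n)%N -> m%:R <= y * log2 n%:R -> 2 ^+ m <= n%:R `^ y.
Proof.
move=> n0 le_m; have n0R : (0 : R) < n%:R by rewrite ltr0n.
have ln2 : 0 < ln 2 :> R by rewrite ln_gt0 // ltr1n.
rewrite -powR_mulrn // /powR pnatr_eq0 /= gt_eqF // ler_expR.
by rewrite -ler_pdivlMr // -mulrA.
Qed.

Lemma trunc_bounds (R : realType) (x : R) :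
  0 <= x -> (Num.truncn x)%:R <= x /\ x - 1 < (Num.truncn x)%:R.
Proof.
move=> x0; split; first by rewrite truncn_le.
by rewrite ltrBlDr natr1 truncnS_gt.
Qed.

Lemma half_le (R : realFieldType) (k : nat) : (k./2)%:R <= k%:R / 2 :> R.
Proof.
rewrite ler_pdivlMr ?ltr0n // -natrM ler_nat muln2 -[leqRHS]odd_double_half.
exact: leq_addl.
Qed.

(** The smallest blocks for which [clique_extension] applies to a [k]-set that
    extends a clique of size [c]. *)
Definition block_size (c k : nat) : nat := 8 * k * 2 ^ (c + k./2).

(** [k] blocks: [part_size 0 k1] is the size of [U] and [part_size k1 k2] that
    of [W]. *)
Definition part_size (c k : nat) : nat := k * block_size c k.

(** Eight times the expected size of the common neighbourhood: 8 times
    [part_size k1 k2] equals [cap_size k2] times 2 ^ k1 for every [k1]. *)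
Definition cap_size (k : nat) : nat := 64 * k * k * 2 ^ k./2.

Lemma part_size_le (R : realFieldType) (c k : nat) (K : R) :
  k%:R <= K -> (part_size c k)%:R <= 8 * K ^+ 2 * 2 ^+ (c + k./2).
Proof.
move=> kK.
have -> : (part_size c k)%:R = 8 * (k%:R * k%:R) * 2 ^+ (c + k./2) :> R.
  by rewrite /part_size /block_size !natrM natrX; ring.
by rewrite ler_wpM2r ?exprn_ge0 // ler_wpM2l // expr2 ler_pM.
Qed.

Lemma cap_size_le (R : realFieldType) (k : nat) (K : R) :
  k%:R <= K -> (cap_size k)%:R <= 64 * K ^+ 2 * 2 ^+ k./2.
Proof.
move=> kK.
have -> : (cap_size k)%:R = 64 * (k%:R * k%:R) * 2 ^+ k./2 :> R.
  by rewrite /cap_size !natrM natrX; ring.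
by rewrite ler_wpM2r ?exprn_ge0 // ler_wpM2l // expr2 ler_pM.
Qed.

(** In this lemma and in [total_probes_le], K is of order log n, the factors of
    order K^2 and K^4 come from the block sizes, and Z is the small power of n
    that absorbs them.  The constant is 4224 = 8 * 8 + 8 * 8 + 64 * 64, for the
    three terms of the number of probes. *)
Lemma total_size_le (R : realFieldType) (k1 k2 : nat) (K X Z : R) :
  1 <= K -> k1%:R <= K -> k2%:R <= K -> 4224 * K ^+ 4 <= Z ->
  2 ^+ k1./2 <= X -> 2 ^+ (k1 + k2./2) <= X ->
  (part_size 0 k1 + part_size k1 k2)%:R <= X * Z.
Proof.
move=> K1 k1K k2K KZ p1X p2X.
have K24 : K ^+ 2 <= K ^+ 4 by rewrite ler_weXn2l.
have K2_0 : 0 <= K ^+ 2 by apply: exprn_ge0; apply: le_trans K1.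
have X0 : 0 <= X by apply: le_trans p1X; apply: exprn_ge0.
rewrite natrD; apply: (@le_trans _ _ (16 * K ^+ 2 * X)).
  have := part_size_le 0 k1K; have := part_size_le k1 k2K; rewrite add0n.
  have := ler_wpM2l K2_0 p1X; have := ler_wpM2l K2_0 p2X; lra.
by rewrite mulrC ler_wpM2l //; lra.
Qed.

Lemma ler_pM_scaled (R : realFieldType) (c d x y p q K Y : R) :
  0 <= c -> 0 <= d -> 0 <= x -> 0 <= y -> x <= c * K ^+ 2 * p -> y <= d * K ^+ 2 * q ->
  0 <= K -> p * q <= Y -> x * y <= c * d * K ^+ 4 * Y.
Proof.
move=> c0 d0 x0 y0 xp yq K0 pqY; apply: le_trans (ler_pM x0 y0 xp yq) _.
rewrite mulrACA (_ : c * K ^+ 2 * (d * K ^+ 2) = c * d * K ^+ 4); last by ring.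
by rewrite ler_wpM2l // !mulr_ge0 // exprn_ge0.
Qed.

Lemma total_probes_le (R : realFieldType) (k1 k2 : nat) (K Y Z : R) :
  0 <= K -> k1%:R <= K -> k2%:R <= K -> 4224 * K ^+ 4 <= Z -> 
  2 ^+ (k1 + k2./2 + k1./2) <= Y -> 2 ^+ (k1./2 + k1./2) <= Y ->
  2 ^+ (k2./2 + k2./2) <= Y ->
  (part_size k1 k2 * part_size 0 k1 + part_size 0 k1 * part_size 0 k1 +
   cap_size k2 * cap_size k2)%:R <= Y * Z.
Proof.
move=> K0 k1K k2K KZ; rewrite !exprD => p21 p11 p22.
set mu := part_size 0 k1; set mw := part_size k1 k2.
have Y0 : 0 <= Y by apply: le_trans p22; rewrite -expr2 sqr_ge0.
have muE : mu%:R <= 8 * K ^+ 2 * 2 ^+ k1./2 := part_size_le 0 k1K.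
have mwE : mw%:R <= 8 * K ^+ 2 * (2 ^+ k1 * 2 ^+ k2./2).
  by rewrite -exprD; exact: part_size_le.
have capE := cap_size_le k2K.
move: mu mw (cap_size k2) muE mwE capE => mu mw cap muE mwE capE.
rewrite !natrD !natrM.
apply: (@le_trans _ _ (4224 * K ^+ 4 * Y)); last by rewrite mulrC ler_wpM2l.
have b1 := ler_pM_scaled (ler0n _ 8) (ler0n _ 8) (ler0n _ _) (ler0n _ _) mwE muE K0 p21.
have b2 := ler_pM_scaled (ler0n _ 8) (ler0n _ 8) (ler0n _ _) (ler0n _ _) muE muE K0 p11.
have b3 := ler_pM_scaled (ler0n _ 64) (ler0n _ 64) (ler0n _ _) (ler0n _ _) capE capE K0 p22.
lra.
Qed.

(** The two clique sizes are a log n and delta log n, each lowered by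
    eps log n and rounded down.  The three exponents in the probe budget are
    a, 3a/2 + delta/2 and delta, all at most delta as 3 a <= delta; the number
    of vertices is governed by a + delta/2 <= 1.  The rounding costs at most 2,
    which is at most 2 eps log n. *)
Lemma two_round_at (R : realType) (n : nat) (a delta eps : R) :
  (0 < n)%N -> 0 < eps -> 2 * eps <= a -> 3 * a <= delta -> a + delta / 2 <= 1 ->
  1 <= eps * log2 n%:R -> 4224 * (2 * log2 n%:R) ^+ 4 <= n%:R `^ eps ->
  exists A : algorithm n, ensures_clique A 2 /\
    ((forall G : graph n, (num_probes A 2 G)%:R <= n%:R `^ delta) /\
     2^-1 <= gnp_prob (2^-1 : R) (fun G : graph n =>
        (a + delta - 4 * eps) * log2 n%:R <= #|result A 2 G|%:R)).
Proof.
move=> n0 eps0 ea a3 a1; set L := log2 n%:R => eL nL.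
have L0 : 0 < L by rewrite -(pmulr_rgt0 _ eps0); apply: lt_le_trans eL.
have n0R : (n%:R == 0 :> R) = false by rewrite pnatr_eq0 gtn_eqF.
have uL : 2 * (eps * L) <= a * L by rewrite mulrA ler_wpM2r // ltW.
have vL : 3 * (a * L) <= delta * L by rewrite mulrA ler_wpM2r // ltW.
have wL : a * L + delta * L / 2 <= L.
  by rewrite mulrAC -mulrDl -[leRHS]mul1r ler_wpM2r // ltW.
have [k1 [k1_le k1_gt]] : exists k : nat, k%:R <= a * L - eps * L /\
    a * L - eps * L - 1 < k%:R.
  by exists (Num.truncn (a * L - eps * L)); apply: trunc_bounds; lra.
have [k2 [k2_le k2_gt]] : exists k : nat, k%:R <= delta * L - eps * L /\
    delta * L - eps * L - 1 < k%:R.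
  by exists (Num.truncn (delta * L - eps * L)); apply: trunc_bounds; lra.
have k1_gt0 : (0 < k1)%N by rewrite -(ltr0n R); lra.
have k2_gt0 : (0 < k2)%N by rewrite -(ltr0n R); lra.
have k1K : k1%:R <= 2 * L by lra.
have k2K : k2%:R <= 2 * L by lra.
have K1 : 1 <= 2 * L by apply: le_trans k1K; rewrite ler1n.
have h1 := half_le R k1; have h2 := half_le R k2.
have pow_le m y : m%:R <= y * L - eps * L -> 2 ^+ m <= n%:R `^ (y - eps).
  by move=> le_m; apply: pow2_le_powR => //; rewrite mulrBl.
have nE y : n%:R `^ (y - eps) * n%:R `^ eps = n%:R `^ y.
  by rewrite -powRD ?subrK // n0R implybT.
pose mu := part_size 0 k1; pose mw := part_size k1 k2.
have le_n : (mu + mw <= n)%N.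
  rewrite -(ler_nat R) -[leRHS]powRr1 // -nE.
  by apply: total_size_le nL _ _ => //; apply: pow_le; rewrite ?natrD mul1r; lra.
have le_budget : (mw * mu + mu * mu + cap_size k2 * cap_size k2)%:R <= n%:R `^ delta :> R.
  rewrite -nE; apply: total_probes_le nL _ _ _ => //; try (apply: pow_le; rewrite !natrD; lra).
  exact: le_trans K1.
have block_gt0 c k : (0 < k)%N -> (0 < block_size c k)%N.
  by move=> k0; rewrite !muln_gt0 expn_gt0 k0.
have [U _ cU] : exists2 U : {set 'I_n}, U \subset finset.setT & #|U| = mu.
  by apply: subset_of_card; rewrite cardsT card_ord (leq_trans _ le_n) ?leq_addr.
have [W sWU cW] : exists2 W : {set 'I_n}, W \subset ~: U & #|W| = mw.
  apply: subset_of_card; rewrite cardsCs finset.setCK cU card_ord.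
  by rewrite leq_subRL // (leq_trans _ le_n) ?leq_addr.
have [S0 sS0U cS0] : exists2 S0 : {set 'I_n}, S0 \subset U & #|S0| = k1.
  by apply: subset_of_card; rewrite cU /mu /part_size leq_pmulr // block_gt0.
have dWU : [disjoint W & U] by rewrite finset.disjoints_subset.
exists (two_round U W S0 (cap_size k2)); split; first exact: two_round_ensures.
split=> [G|].
  apply: le_trans le_budget; rewrite ler_nat.
  by apply: leq_trans (two_round_probes _ _ _ _ _) _; rewrite cU cW.
rewrite gnp_prob_half.
apply: (@le_trans _ _ (mean (fun G : graph n =>
    (#|S0| + k2 <= #|result (two_round U W S0 (cap_size k2)) 2 G|)%N%:R))); last first.
  apply: le_mean => G; rewrite ler_nat.
  case: (leqP (#|S0| + k2) #|result _ 2 G|) => //= le_res; rewrite lt0b.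
  apply: (@le_trans _ _ (#|S0| + k2)%:R); last by rewrite ler_nat.
  by rewrite natrD cS0; clear - k1_gt k2_gt eL; lra.
apply: (@two_round_prob _ _ _ _ _ (block_size 0 k1) (block_size k1 k2)) => //.
- exact: block_gt0.
- by rewrite cS0 cU.
- by rewrite cS0.
- exact: block_gt0.
- by rewrite cW.
- by rewrite cS0.
- by rewrite !muln_gt0 expn_gt0 k2_gt0.
- rewrite cS0 cW /mw /part_size /block_size /cap_size expnD.
  by apply: eq_leq; ring.
Qed.

(** By x^5 / 5! <= exp x at x = c L, it is enough that L exceeds a constant. *)
Lemma quartic_le_expR (R : realType) (c D L : R) :
  0 < c -> 0 <= D -> D * 5`!%:R / c ^+ 5 <= L -> D * L ^+ 4 <= expR (c * L).
Proof.
move=> c0 D0 DL; have f0 : 0 < 5`!%:R :> R by rewrite ltr0n fact_gt0.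
have L0 : 0 <= L.
  by apply: le_trans DL; rewrite divr_ge0 // ?mulr_ge0 ?exprn_ge0 // ltW.
have cL0 : 0 <= c * L by rewrite mulr_ge0 // ltW.
apply: le_trans (expR_ge1Dxn 4 cL0).
rewrite -[leLHS]add0r lerD // ler_pdivlMr // mulrAC exprMn [L ^+ 5]exprS [leRHS]mulrA.
by rewrite ler_wpM2r ?exprn_ge0 // [leRHS]mulrC -ler_pdivrMr ?exprn_gt0.
Qed.

Lemma achievable_two_rounds (R : realType) (a delta eps : R) :
  0 < eps -> 2 * eps <= a -> 3 * a <= delta -> a + delta / 2 <= 1 ->
  achievable delta 2 (a + delta - 4 * eps).
Proof.
move=> eps0 ea a3 a1.
have ln2 : 0 < ln 2 :> R by rewrite ln_gt0 // ltr1n.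
have c0 : 0 < eps * ln 2 by rewrite mulr_gt0.
(* The constant is kept abstract, since only its sign matters. *)
have [D D0 DE] : exists2 D : R, 0 <= D & 4224 * 2 ^+ 4 = D.
  by eexists; last reflexivity; rewrite mulr_ge0 ?exprn_ge0 ?ler0n.
pose C : R := Num.max eps^-1 (D * 5`!%:R / (eps * ln 2) ^+ 5).
have at_n n : exists A : algorithm n, ensures_clique A 2 /\
    ((0 < n)%N -> C <= log2 n%:R ->
     (forall G : graph n, (num_probes A 2 G)%:R <= n%:R `^ delta) /\
     2^-1 <= gnp_prob (2^-1 : R) (fun G : graph n =>
        (a + delta - 4 * eps) * log2 n%:R <= #|result A 2 G|%:R)).
  have [/andP[n0 CL]|nC] := boolP ((0 < n)%N && (C <= log2 n%:R)); last first.
    exists (two_round finset.set0 finset.set0 finset.set0 0); split.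
      exact: two_round_ensures.
    by move=> n0 CL; rewrite n0 CL in nC.
  have [||A [clA goodA]] := @two_round_at R n a delta eps n0 eps0 ea a3 a1.
  - rewrite mulrC -ler_pdivrMr // div1r; apply: le_trans CL.
    by rewrite /C le_max lexx.
  - have n0R : (0 : R) < n%:R by rewrite ltr0n.
    have -> : n%:R `^ eps = expR (eps * ln 2 * log2 n%:R).
      by rewrite /powR gt_eqF // /log2; congr expR; field; rewrite gt_eqF.
    rewrite exprMn [leLHS]mulrA DE; apply: quartic_le_expR => //.
    by apply: le_trans CL; rewrite /C le_max lexx orbT.
  by exists A; split => // _ _; exact: goodA.
exists (fun n => projT1 (cid (at_n n))); split.
  by move=> n; case: (cid _) => A [].
near=> n.
have n_big : expR (C * ln 2) <= n%:R by near: n; apply: nbhs_infty_ger.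
have n0R : (0 : R) < n%:R by apply: lt_le_trans n_big; apply: expR_gt0.
case: (cid _) => A [_ good] /=; apply: good; first by rewrite -(ltr0n R).
by rewrite /log2 ler_pdivlMr // -(expRK (C * ln 2)) ler_ln ?posrE ?expR_gt0.
Unshelve. all: by end_near.
Qed.

(** * The bound on the supremum *)

(** The supremum absorbs the loss of 4 eps, for every small eps. *)
Lemma alpha_star_two_rounds (R : realType) (a delta : R) :
  0 < a -> 3 * a <= delta -> a + delta / 2 <= 1 ->
  ((a + delta)%:E <= alpha_star delta 2)%E.
Proof.
move=> a0 a3 a1; apply/lee_subgt0Pr => e e0.
pose eps := Num.min (e / 4) (a / 2).
have eps0 : 0 < eps by rewrite lt_min !divr_gt0.
have [eps_e eps_a] : eps <= e / 4 /\ eps <= a / 2.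
  by rewrite /eps !ge_min !lexx orbT.
have ach : achievable delta 2 (a + delta - 4 * eps).
  by apply: achievable_two_rounds => //; lra.
apply: (@le_trans _ _ (a + delta - 4 * eps)%:E); first by rewrite -EFinB lee_fin; lra.
by apply: ereal_sup_ubound; exists (a + delta - 4 * eps).
Qed.

Theorem lemma5 (R : realType) :
  (forall delta : R, 1 <= delta <= 6 / 5 ->
     ((4 * delta / 3)%:E <= alpha_star delta 2)%E) /\
  (forall delta : R, 6 / 5 <= delta < 2 ->
     ((1 + delta / 2)%:E <= alpha_star delta 2)%E).
Proof.
split=> delta /andP[d1 d2].
  have -> : 4 * delta / 3 = delta / 3 + delta by field.
  by apply: alpha_star_two_rounds; lra.
have -> : 1 + delta / 2 = (1 - delta / 2) + delta by field.
by apply: alpha_star_two_rounds; lra.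
Qed.
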